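(* Let $q\ge 2$, $n\ge 2$ and $1\le t_1\le t_2\le n-1$ be integers. Then $$S_{t_1}^{t_2}(q,n)\ \ge\ q^{\,n-k-1}\left(q-\left\lfloor\frac{k}{k+1}\cdot q\right\rfloor\right)\left\lfloor\frac{k}{k+1}\cdot q\right\rfloor^{k},$$ where $k=t_2$ if $t_1+t_2\le n$, and $k=n-t_1$ otherwise.
   Context: Let $\Sigma$ be a finite alphabet with $q\ge 2$ letters. Two (not necessarily distinct) words $u,v$ over $\Sigma$ have a $t$-overlap if the prefix of $u$ of length $t$ equals the suffix of $v$ of length $t$, or vice versa. A code $C\subseteq\Sigma^n$ ($n\ge 2$) is $(t_1,t_2)$-overlap-free if for all $t_1\le t\le t_2$ no two (not necessarily distinct) codewords in $C$ have a $t$-overlap. $S_{t_1}^{t_2}(q,n)$ denotes the maximum size of a $(t_1,t_2)$-overlap-free code $C\subseteq\Sigma^n$ with $|\Sigma|=q$. *)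

(* Defs.v *)
From mathcomp Require Import all_boot.

Set Implicit Arguments.
Unset Strict Implicit.
Unset Printing Implicit Defensive.

(* Only meaningful for t <= n: beyond that [take] and [drop] return the whole
   word. *)
Definition overlap (Sigma : finType) (n t : nat) (u v : n.-tuple Sigma) : bool :=
  (take t u == drop (n - t) v) || (take t v == drop (n - t) u).

Definition overlap_free (Sigma : finType) (n t1 t2 : nat)
    (C : {set n.-tuple Sigma}) : bool :=
  [forall t : 'I_t2.+1, (t1 <= t) ==>
    [forall u in C, forall v in C, ~~ overlap t u v]].

(* S_{t1}^{t2}(q,n), with q = #|Sigma|.  The maximum ranges over a nonempty
   family, since the empty code is overlap-free. *)
Definition max_overlap_free (Sigma : finType) (n t1 t2 : nat) : nat :=
  \max_(C : {set n.-tuple Sigma} | overlap_free t1 t2 C) #|C|.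

(* Main.v *)
Require Import Defs.
From mathcomp Require Import all_boot zify.

(** A set [J] of letters with complement [I] gives a code: all words whose first
    letter is in [I] and whose letters at the positions [n - t], for
    [t1 <= t <= t2], are in [J].  A [t]-overlap would identify a first letter
    with a letter at position [n - t].  With [#|J| = m] and [d = t2 - t1 + 1]
    this code has [(q - m) * m ^ d * q ^ (n - 1 - d)] words, and since [m <= q]
    and [d <= k], this is at least the required bound. *)

(** Transports [card_family] from finite functions to tuples along the injection [f], whose image of
    the family is exactly this set. *)
Lemma card_tuple_family (T : finType) (n : nat) (A : 'I_n -> {set T}) :
  #|[set w : n.-tuple T | [forall i, tnth w i \in A i]]| = \prod_(i < n) #|A i|.
Proof.
transitivity #|family A|; last by rewrite card_family foldrE big_image.
pose f (g : {ffun 'I_n -> T}) : n.-tuple T := [tuple g i | i < n].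
have f_inj : injective f.
  by move=> g h /(congr1 (@tnth _ _)) e; apply/ffunP=> i;
    move: (congr1 (fun k => k i) e); rewrite !tnth_mktuple.
rewrite -(card_imset _ f_inj); apply: eq_card => w; rewrite !inE.
apply/forallP/imsetP => [wA | [g gA ->] i].
  exists [ffun i => tnth w i]; first by apply/familyP => i; rewrite ffunE.
  by apply: eq_from_tnth => i; rewrite tnth_mktuple ffunE.
by rewrite tnth_mktuple; move/familyP: gA; apply.
Qed.

Lemma exists_set_card (T : finType) (m : nat) :
  m <= #|T| -> exists A : {set T}, #|A| = m.
Proof.
move=> le_mT; exists [set x in take m (enum T)].
rewrite cardsE (card_uniqP _) ?take_uniq ?enum_uniq //.
by rewrite size_takel // -cardE.
Qed.

(** The position is a plain [nat], so that the product of the cardinals can be cut into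
    intervals. *)
Definition window_letters {Sigma : finType} (n t1 t2 : nat) (J : {set Sigma})
    (i : nat) : {set Sigma} :=
  if i == 0 then ~: J else if n - t2 <= i <= n - t1 then J else setT.

Definition window_code {Sigma : finType} (n t1 t2 : nat) (J : {set Sigma}) :
    {set n.-tuple Sigma} :=
  [set w | [forall i, tnth w i \in window_letters n t1 t2 J i]].

Section WindowCode.

Variables (Sigma : finType) (n t1 t2 : nat) (J : {set Sigma}).
Hypotheses (t1_gt0 : 0 < t1) (t1_le_t2 : t1 <= t2) (t2_lt_n : t2 < n).

Lemma window_code_prefix_neq_suffix (t : nat) (u v : n.-tuple Sigma) :
  t1 <= t <= t2 -> u \in window_code n t1 t2 J -> v \in window_code n t1 t2 J ->
  take t u != drop (n - t) v.
Proof.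
case/andP=> t1_le_t t_le_t2; rewrite !inE => /forallP uJ /forallP vJ.
have t_gt0 := leq_trans t1_gt0 t1_le_t.
have t_lt_n := leq_ltn_trans t_le_t2 t2_lt_n.
have n_gt0 := leq_ltn_trans (leq0n _) t2_lt_n.
have pos_lt_n : n - t < n by rewrite ltn_subrL t_gt0.
apply/eqP => e.
set x0 := tnth u (Ordinal n_gt0).
have: nth x0 (take t u) 0 = nth x0 (drop (n - t) v) 0 by rewrite e.
rewrite nth_take // nth_drop addn0 => e0.
have := uJ (Ordinal n_gt0); rewrite (tnth_nth x0) /window_letters /= e0 inE.
have := vJ (Ordinal pos_lt_n); rewrite (tnth_nth x0) /window_letters /=.
by rewrite subn_eq0 leqNgt t_lt_n /= !leq_sub2l //= => ->.
Qed.

Lemma window_code_overlap_free : overlap_free t1 t2 (window_code n t1 t2 J).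
Proof.
apply/forallP => t; apply/implyP => t1_le_t.
have t_in : t1 <= t <= t2 by rewrite t1_le_t -ltnS ltn_ord.
apply/forall_inP => u uC; apply/forall_inP => v vC.
by rewrite negb_or !window_code_prefix_neq_suffix.
Qed.

Lemma card_window_code :
  #|window_code n t1 t2 J|
    = (#|Sigma| - #|J|) * #|J| ^ (t2 - t1).+1 * #|Sigma| ^ (n - 1 - (t2 - t1).+1).
Proof.
rewrite card_tuple_family -(big_mkord xpredT (fun i => #|window_letters n t1 t2 J i|)).
have n_gt0 := leq_ltn_trans (leq0n _) t2_lt_n.
have lo_gt0 : 0 < n - t2 by rewrite subn_gt0.
have lo_le_hi : n - t2 <= (n - t1).+1 by rewrite leqW // leq_sub2l.
have hi_le_n : (n - t1).+1 <= n by rewrite ltn_subrL t1_gt0.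
(* Four blocks: position 0, the free positions before the window, the window, and the free positions
   after it. *)
rewrite big_ltn // (big_cat_nat lo_gt0) ?leq_subr //= (big_cat_nat lo_le_hi) //=.
have -> : \prod_(1 <= i < n - t2) #|window_letters n t1 t2 J i|
          = #|Sigma| ^ (n - t2 - 1).
  rewrite -prod_nat_const_nat; apply: eq_big_nat => i /andP[i_gt0 i_lt].
  by rewrite /window_letters eqn0Ngt i_gt0 leqNgt i_lt cardsT.
have -> : \prod_(n - t2 <= i < (n - t1).+1) #|window_letters n t1 t2 J i|
          = #|J| ^ (t2 - t1).+1.
  have -> : (t2 - t1).+1 = (n - t1).+1 - (n - t2) by lia.
  rewrite -prod_nat_const_nat; apply: eq_big_nat => i /andP[lo_le i_lt].
  by rewrite /window_letters eqn0Ngt (leq_trans lo_gt0 lo_le) lo_le -[i <= _]ltnS i_lt.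
have -> : \prod_((n - t1).+1 <= i < n) #|window_letters n t1 t2 J i|
          = #|Sigma| ^ (n - (n - t1).+1).
  rewrite -prod_nat_const_nat; apply: eq_big_nat => i /andP[hi_lt _].
  rewrite /window_letters eqn0Ngt (leq_ltn_trans (leq0n _) hi_lt).
  by rewrite [i <= _]leqNgt hi_lt andbF cardsT.
have -> : n - 1 - (t2 - t1).+1 = (n - t2 - 1) + (n - (n - t1).+1) by lia.
rewrite /window_letters eqxx [#|~: J|]cardsCs setCK expnD -[RHS]mulnA.
by congr (_ * _); rewrite mulnCA.
Qed.

End WindowCode.

Theorem corollary2 (Sigma : finType) (q n t1 t2 : nat)
    (card_Sigma : #|Sigma| = q) (q_ge2 : 2 <= q) (n_ge2 : 2 <= n)
    (t1_ge1 : 1 <= t1) (t1_le_t2 : t1 <= t2) (t2_le : t2 <= n - 1) :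
  let k := if t1 + t2 <= n then t2 else n - t1 in
  q ^ (n - k - 1) * (q - (k * q) %/ (k + 1)) * ((k * q) %/ (k + 1)) ^ k
    <= max_overlap_free Sigma n t1 t2.
Proof.
(* [m] is the integer part of the real maximiser of [(q - x) * x ^ k] on the interval from 0 to [q];
   [d] is the length of the window. *)
cbv zeta; set k := (if _ then _ else _); set m := _ %/ _; set d := (t2 - t1).+1.
have t2_lt_n : t2 < n by lia.
have m_le_q : m <= q by rewrite /m -ltnS ltn_divLR; nia.
have [J card_J] : exists J : {set Sigma}, #|J| = m.
  by apply: exists_set_card; rewrite card_Sigma.
have code_le : #|window_code n t1 t2 J| <= max_overlap_free Sigma n t1 t2.
  by apply: leq_bigmax_cond; apply: window_code_overlap_free.
apply: leq_trans code_le.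
rewrite card_window_code // card_Sigma card_J -/d.
(* If [k = t2] this is [1 <= t1]; if [k = n - t1] it is [t2 < n]. *)
have d_le_k : d <= k by rewrite /d /k; case: ifP; lia.
have k_lt_n : k < n by rewrite /k; case: ifP; lia.
(* The bound restricts [k] positions to [m] letters, the code only [d]; on the other [k - d] it has
   [q] choices instead of [m]. *)
have -> : n - 1 - d = (k - d) + (n - k - 1) by lia.
have m_exp_le : m ^ (k - d) <= q ^ (k - d).
  (* [leq_exp2r] needs a positive exponent, hence the separate case [k = d]. *)
  by case: (posnP (k - d)) => [-> // | kd_gt0]; rewrite leq_exp2r.
rewrite -[in m ^ k](subnK d_le_k) !expnD.
rewrite (mulnC (q ^ (n - k - 1))) -!mulnA leq_mul2l; apply/orP; right.
by rewrite mulnC [leqRHS]mulnC mulnAC !leq_mul2r m_exp_le !orbT.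
Qed.
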